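(* A function $\tau:[1,\infty)\to\mathbb{R}$ is the mass exponent of some sequence $(\mu_n)_n$ of probability measures, $\mu_n$ on $\{1,\dots,n\}$, if and only if it satisfies the following three properties: (a) $0\ge \tau(q)\ge 1-q$ for all $q\ge 1$; (b) $\tau$ is convex; (c) $\frac{\tau(q)}{q}\ge \tau'(q)$ for all $q\ge 1$, where $\tau'(q)$ denotes the right-sided derivative of $\tau$ at $q$.
   Context: For a sequence of probability measures $\mu_n$ on $\{1,\dots,n\}$ ($n\ge 2$), identified with vectors $(\mu_n(1),\dots,\mu_n(n))\in\mathbb{R}^n$, the mass exponent is the function $\tau:[1,\infty)\to\mathbb{R}$, $\tau(q)=\limsup_{n\to\infty}\frac{\log\sum_{i=1}^n\mu_n(i)^q}{\log n}$. *)

(* Defs.v *)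
From HB Require Import structures.
From mathcomp Require Import all_boot all_order all_algebra.
From mathcomp Require Import all_classical all_reals all_analysis.

Set Implicit Arguments.
Unset Strict Implicit.
Unset Printing Implicit Defensive.

Import Order.TTheory GRing.Theory Num.Theory.
Import numFieldNormedType.Exports.

Local Open Scope classical_set_scope.
Local Open Scope ring_scope.

(* A probability measure on {1, ..., n} is identified with its vector of
   masses; the point k of {1, ..., n} has index k - 1 in 'I_n. *)
Definition prob_vector (R : realType) (n : nat) (p : 'rV[R]_n) : Prop :=
  (forall i : 'I_n, 0 <= p 0 i) /\ \sum_(i < n) p 0 i = 1.

(* The terms n = 0 and n = 1 (where ln n%:R = 0) have no influence on the
   limsup.  It is taken in \bar R so that its value never depends on a
   boundedness side condition. *)
Definition mass_exponent (R : realType) (mu : forall n : nat, 'rV[R]_n)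
    (q : R) : \bar R :=
  limn_esup (fun n : nat =>
    (ln (\sum_(i < n) (mu n 0 i `^ q)) / ln (n%:R : R))%:E).

(* [mu 0] and [mu 1] are unconstrained: there is no probability measure on the
   empty set, and the sequence starts at n = 2.  A function [1, +oo[ -> R is
   represented by a total function, whose values below 1 are never used. *)
Definition is_mass_exponent (R : realType) (mu : forall n : nat, 'rV[R]_n)
    (tau : R -> R) : Prop :=
  (forall n : nat, (2 <= n)%N -> prob_vector (mu n)) /\
  (forall q : R, 1 <= q -> mass_exponent mu q = (tau q)%:E).

Definition right_quotient (R : realType) (f : R -> R) (q h : R) : R :=
  h^-1 * (f (q + h) - f q).

Definition right_derivable (R : realType) (f : R -> R) (q : R) : Prop :=
  cvg (right_quotient f q h @[h --> 0^'+]).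

Definition right_derive (R : realType) (f : R -> R) (q : R) : R :=
  lim (right_quotient f q h @[h --> 0^'+]).

(* Main.v *)
Require Import Defs.
From HB Require Import structures.
From mathcomp Require Import all_boot all_order all_algebra.
From mathcomp Require Import all_classical all_reals all_analysis.
From mathcomp Require Import lra ring.

Set Implicit Arguments.
Unset Strict Implicit.
Unset Printing Implicit Defensive.

Import Order.TTheory GRing.Theory Num.Theory.
Import numFieldNormedType.Exports.

Local Open Scope classical_set_scope.
Local Open Scope ring_scope.

(**
   The sum S_n(q) of the q-th powers of the masses satisfies n^(1-q) <= S_n(q)
   <= 1, log S_n is convex, and S_n(q)^(1/q) is nonincreasing in q.  All three
   facts survive division by log n and the limsup; the last one says that
   tau(q)/q is nonincreasing, which is (c).

   Conversely, for tau with (a), (b), (c), the support line of tau at x >= 1 is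
   q |-> A - B q with 0 <= A <= B <= 1: A >= 0 is (c), A <= B is the support
   inequality at 1, and B <= 1 follows from tau(q) >= 1 - q.  Such a line is
   realized up to constants by n^A points of mass n^(-B), the remaining mass
   being spread uniformly; the latter contributes at most n^(1-q), which is
   harmless by (a).  As tau is a limsup, it is enough that mu_n realizes a
   single line, provided that the points x run through a dense set, each
   neighbourhood being visited infinitely often.
*)

(** * Limits superior of real sequences *)

Lemma limn_esup_EFinP (R : realType) (u : nat -> R) (l : R) :
  limn_esup (fun n => (u n)%:E) = l%:E <->
  (forall e, 0 < e -> \forall n \near \oo, u n <= l + e) /\
  (forall e, 0 < e -> forall N, exists2 n, (N <= n)%N & l - e <= u n).
Proof.
rewrite /limn_esup limf_esupE; split.
- move=> ul; split=> e e0.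
  + have : (l%:E < (l + e)%:E)%E by rewrite lte_fin ltrDl.
    rewrite -{1}ul => /ereal_inf_lt [_ [V V_oo <-] supV].
    apply: filterS V_oo => n Vn; rewrite -lee_fin; apply: le_trans (ltW supV).
    by apply: ereal_sup_ubound; exists n.
  + move=> N.
    have : ((l - e)%:E <
        ereal_sup [set (u n)%:E | n in [set n | (N <= n)%N]])%E.
      apply: (@lt_le_trans _ _ l%:E); first by rewrite lte_fin gtrBl.
      rewrite -ul; apply: ereal_inf_lbound; eexists; last reflexivity.
      exact: nbhs_infty_ge.
    move=> /ereal_sup_gt [_ [n Nn <-]]; rewrite lte_fin => /ltW lun.
    by exists n.
- move=> [u_le u_ge]; apply/eqP; rewrite eq_le; apply/andP; split.
  + apply/lee_addgt0Pr => e e0; rewrite -EFinD.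
    apply: (@le_trans _ _
        (ereal_sup [set (u n)%:E | n in [set n | u n <= l + e]])).
      by apply: ereal_inf_lbound; eexists; [exact: u_le e e0|].
    by apply: ge_ereal_sup => _ [n /= un <-]; rewrite lee_fin.
  + apply: le_ereal_inf_tmp => _ [V [N _ NV] <-].
    apply/lee_addgt0Pr => e e0.
    have [n Nn lun] := u_ge e e0 N.
    apply: (@le_trans _ _ ((u n)%:E + e%:E)%E).
      by rewrite -EFinD lee_fin -lerBlDr.
    by apply: leeD2r; apply: ereal_sup_ubound; exists n => //; apply: NV.
Qed.

(** At an index n where u is nearly its limsup, and far enough out for v and w to exceed theirs by
    at most [d], the pointwise inequality transfers to the limits. Bounds, convexity and
    monotonicity of a mass exponent all come from it by choosing a and b. *)
Lemma limn_esup_affine_le (R : realType) (u v w : nat -> R)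
    (lu lv lw a b : R) : 0 <= a -> 0 <= b ->
  limn_esup (fun n => (u n)%:E) = lu%:E ->
  limn_esup (fun n => (v n)%:E) = lv%:E ->
  limn_esup (fun n => (w n)%:E) = lw%:E ->
  (\forall n \near \oo, u n <= a * v n + b * w n) ->
  lu <= a * lv + b * lw.
Proof.
move=> a0 b0 /limn_esup_EFinP[_ u_ge] /limn_esup_EFinP[v_le _].
move=> /limn_esup_EFinP[w_le _] uvw; apply/ler_addgt0Pr => e e0.
(* The errors of v, w and u add up to a d + b d + d, which this choice makes equal to e. *)
pose d := e / (a + b + 1).
have d0 : 0 < d by rewrite divr_gt0// ltr_wpDl ?addr_ge0.
have [N _ HN] : \forall n \near \oo,
    [/\ u n <= a * v n + b * w n, v n <= lv + d & w n <= lw + d].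
  by near=> n; split; near: n; [|exact: v_le|exact: w_le].
have [n Nn un] := u_ge d d0 N.
have [uvn vn wn] := HN n Nn.
have de : e = d * (a + b + 1).
  by rewrite divfK// gt_eqF// ltr_wpDl ?addr_ge0.
have avn := ler_wpM2l a0 vn.
have bwn := ler_wpM2l b0 wn.
rewrite de; lra.
Unshelve. all: by end_near. Qed.

Lemma limn_esup_cst (R : realType) (c : R) :
  limn_esup (fun=> c%:E) = c%:E.
Proof.
apply/limn_esup_EFinP; split=> e e0.
  by apply: nearW => n; rewrite lerDl ltW.
by move=> N; exists N => //; rewrite gerBl ltW.
Qed.

(** * Elementary inequalities for exponentials and powers *)

Lemma expR_wmean (R : realType) (t a b : R) : 0 <= t <= 1 ->
  expR (t * a + (1 - t) * b) <= t * expR a + (1 - t) * expR b.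
Proof. by case/andP=> t0 t1; have := convex_expR (Itv01 t0 t1) a b. Qed.

(** Convexity of exp between q ln x and 0, with weights 1/q and 1 - 1/q, gives x <= x^q/q + 1 - 1/q;
    multiply by q. The case x = 0 is checked directly. *)
Lemma powR_bernoulli (R : realType) (x q : R) : 0 <= x -> 1 <= q ->
  1 + q * (x - 1) <= x `^ q.
Proof.
move=> x0 q1; have q0 : 0 < q by rewrite (lt_le_trans (@ltr01 R)).
have [->|xneq] := eqVneq x 0; first by rewrite powR0 ?gt_eqF//; lra.
have {x0}x0 : 0 < x by rewrite lt0r xneq.
have t01 : 0 <= q^-1 <= 1 by rewrite invr_ge0 ltW//= invf_le1.
have := expR_wmean (q * ln x) 0 t01.
rewrite mulr0 addr0 mulKf ?gt_eqF// lnK// expR0 mulr1.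
rewrite /powR (negbTE xneq) -(ler_pM2l q0) mulrDr mulVKf ?gt_eqF//.
by rewrite mulrBr mulr1 mulfV ?gt_eqF//; lra.
Qed.

Lemma powR_bool_mul (R : realType) (c : bool) (x q : R) : 0 < q ->
  (c%:R * x) `^ q = c%:R * x `^ q.
Proof. by case: c => q0; rewrite ?mul1r// !mul0r powR0// gt_eqF. Qed.

(** The sum is at most twice its larger term, which by symmetry may be taken to be y. *)
Lemma powRD_le (R : realType) (x y q : R) : 0 <= x -> 0 <= y -> 0 <= q ->
  (x + y) `^ q <= 2 `^ q * (x `^ q + y `^ q).
Proof.
move=> + + q0; wlog xy : x y / x <= y => [wl x0 y0|x0 y0].
  have [xy|/ltW yx] := leP x y; first exact: wl.
  by rewrite addrC [X in _ * X]addrC; exact: wl.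
apply: (@le_trans _ _ ((2 * y) `^ q)).
  by rewrite ge0_ler_powR ?nnegrE ?addr_ge0 ?mulr_ge0//; lra.
rewrite powRM//; apply: ler_wpM2l; first exact: powR_ge0.
by rewrite lerDr powR_ge0.
Qed.

(** * Power sums of a single probability vector *)

Section power_sum.
Context {R : realType} {n : nat} (p : 'rV[R]_n).
Hypothesis pP : prob_vector p.

Let p_ge0 i : 0 <= p 0 i. Proof. by case: pP. Qed.

Lemma prob_vector_le1 i : p 0 i <= 1.
Proof.
case: pP => _ <-; rewrite (bigD1 i)//= lerDl.
by apply: sumr_ge0 => j _; exact: p_ge0.
Qed.

Lemma prob_vector_pos : exists i, 0 < p 0 i.
Proof.
apply/not_existsP => p0; case: pP => _ /esym/eqP.
rewrite big1 ?oner_eq0// => i _.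
by apply/eqP; rewrite eq_le p_ge0 andbT leNgt; apply/negP/p0.
Qed.

Lemma power_sum_gt0 q : 0 < \sum_(i < n) p 0 i `^ q.
Proof.
have [i pi0] := prob_vector_pos; rewrite (bigD1 i)//=.
rewrite ltr_pwDl ?powR_gt0//; apply: sumr_ge0 => j _; exact: powR_ge0.
Qed.

Lemma power_sum_le1 q : 1 <= q -> \sum_(i < n) p 0 i `^ q <= 1.
Proof.
move=> q1; case: pP => _ <-; apply: ler_sum => i _.
have [->|pi0] := eqVneq (p 0 i) 0.
  by rewrite powR0// gt_eqF// (lt_le_trans (@ltr01 R)).
by rewrite ge1r_powR// lt0r pi0 p_ge0 prob_vector_le1.
Qed.

(** Jensen's inequality in disguise: apply [powR_bernoulli] at x = n p_i and sum; the linear parts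
    cancel because the numbers n p_i - 1 add up to 0. *)
Lemma power_sum_ge q : 1 <= q -> n%:R `^ (1 - q) <= \sum_(i < n) p 0 i `^ q.
Proof.
move=> q1.
have [i0 _] := prob_vector_pos.
have n0 : 0 < n%:R :> R by rewrite ltr0n; case: (n) i0 => [[]|].
rewrite powRB; last by rewrite lt0r_neq0 ?implybT.
rewrite ler_pdivrMr ?powR_gt0// powRr1 ?ler0n// mulr_suml.
have n_sum : n%:R = \sum_(i < n) (1 + q * (p 0 i * n%:R - 1)) :> R.
  rewrite big_split/= -mulr_sumr sumrB -mulr_suml; case: pP => _ ->.
  by rewrite sumr_const card_ord mul1r subrr mulr0 addr0.
rewrite [leLHS]n_sum; apply: ler_sum => i _; rewrite -powRM ?ler0n//.
by apply: powR_bernoulli => //; rewrite mulr_ge0// ler0n.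
Qed.

(** Hoelder's inequality: once p^q is divided by [A] and p^r by [B], so that both sum to 1, the
    claim holds term by term by convexity of exp. *)
Lemma ln_power_sum_convex (t q r : R) : 0 <= t <= 1 -> 1 <= q -> 1 <= r ->
  ln (\sum_(i < n) p 0 i `^ (t * q + (1 - t) * r)) <=
  t * ln (\sum_(i < n) p 0 i `^ q) + (1 - t) * ln (\sum_(i < n) p 0 i `^ r).
Proof.
move=> t01 q1 r1; have /andP[t0 t1] := t01.
have A0 := power_sum_gt0 q; have B0 := power_sum_gt0 r.
set A := \sum_(i < n) p 0 i `^ q in A0 *.
set B := \sum_(i < n) p 0 i `^ r in B0 *.
set m := t * q + (1 - t) * r.
have m0 : 0 < m by rewrite /m; nra.
set c := t * ln A + (1 - t) * ln B.
rewrite -ler_expR lnK ?posrE ?power_sum_gt0//.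
rewrite -[leRHS]mul1r -ler_pdivrMr ?expR_gt0// mulr_suml.
have -> : 1 = \sum_(i < n) (t * (p 0 i `^ q / A) + (1 - t) * (p 0 i `^ r / B)).
  rewrite big_split/= -!mulr_sumr -!mulr_suml.
  by rewrite -/A -/B !mulfV ?gt_eqF// !mulr1 subrKC.
apply: ler_sum => i _; have [->|pi_neq0] := eqVneq (p 0 i) 0.
  have q0 : 0 < q by exact: lt_le_trans q1.
  have r0 : 0 < r by exact: lt_le_trans r1.
  by rewrite !powR0 ?lt0r_neq0// !mul0r !mulr0 addr0.
have := expR_wmean (q * ln (p 0 i) - ln A) (r * ln (p 0 i) - ln B) t01.
rewrite /powR (negbTE pi_neq0) -expRB.
rewrite (_ : t * (_ - _) + _ = m * ln (p 0 i) - c); last by rewrite /m /c; ring.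
by rewrite (expRB (q * _)) (expRB (r * _)) !lnK.
Qed.

(** Monotonicity of l^q norms: each p_i^q is at most the power sum [A], so p_i^r = p_i^q
    (p_i^q)^(r/q - 1) <= p_i^q A^(r/q - 1), and the right-hand sides sum to A^(r/q). *)
Lemma ln_power_sum_homo (q r : R) : 1 <= q -> q <= r ->
  ln (\sum_(i < n) p 0 i `^ r) <= r / q * ln (\sum_(i < n) p 0 i `^ q).
Proof.
move=> q1 qr; have q0 : 0 < q by rewrite (lt_le_trans (@ltr01 R)).
have A0 := power_sum_gt0 q.
set A := \sum_(i < n) p 0 i `^ q in A0 *.
have s1 : 1 <= r / q by rewrite ler_pdivlMr// mul1r.
rewrite -ln_powR ler_ln ?posrE ?power_sum_gt0 ?powR_gt0//.
have s0 : 0 < r / q by exact: lt_le_trans s1.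
rewrite -(mulr_powRB1 (ltW A0) s0).
rewrite {1}/A mulr_suml; apply: ler_sum => i _.
rewrite -{1}(divfK (lt0r_neq0 q0) r) mulrC powRrM.
rewrite -(mulr_powRB1 _ s0) ?powR_ge0//.
apply: ler_wpM2l; first exact: powR_ge0.
rewrite ge0_ler_powR ?nnegrE ?subr_ge0 ?powR_ge0 ?(ltW A0)//.
by rewrite /A (bigD1 i)//= lerDl sumr_ge0// => j _; exact: powR_ge0.
Qed.

End power_sum.

(** * Right derivatives of convex functions on the half-line from 1 *)

Section right_derivative_convex.
Context {R : realType} (f : R -> R).
Hypothesis f_convex : convex_function [set q : R^o | 1 <= q] f.

(** Clearing denominators makes the degenerate case x = z harmless; otherwise y is the convex
    combination with weight (z - y)/(z - x) on x. *)
Lemma convex_three_points (x y z : R) : 1 <= x -> x <= y -> y <= z ->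
  (z - x) * f y <= (z - y) * f x + (y - x) * f z.
Proof.
move=> x1 xy yz; have [zx|xz] := leP z x.
  have -> : y = x by lra.
  have -> : z = x by lra.
  by rewrite !subrr !mul0r addr0.
have zx0 : 0 < z - x by rewrite subr_gt0.
have t0 : 0 <= (z - y) / (z - x) by rewrite divr_ge0 ?subr_ge0// ltW.
have t1 : (z - y) / (z - x) <= 1 by rewrite ler_pdivrMr// mul1r; lra.
have /= := @f_convex (Itv01 t0 t1) x z.
rewrite !inE/= => /(_ x1 (le_trans x1 (ltW xz))).
rewrite !convRE/= => fy.
have yE : (z - y) / (z - x) * x + (1 - (z - y) / (z - x)) * z = y.
  by field; rewrite gt_eqF.
have : f y <= (z - y) / (z - x) * f x + (1 - (z - y) / (z - x)) * f z.
  by rewrite -{1}yE; exact: fy.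
rewrite -(ler_pM2l zx0) => /le_trans; apply.
rewrite le_eqVlt; apply/orP; left; apply/eqP.
by field; rewrite gt_eqF.
Qed.

Lemma right_quotient_homo (q h k : R) : 1 <= q -> 0 < h -> h <= k ->
  right_quotient f q h <= right_quotient f q k.
Proof.
move=> q1 h0 hk; have k0 : 0 < k by exact: lt_le_trans hk.
rewrite /right_quotient ler_pdivrMl// mulrCA ler_pdivlMl//.
have := @convex_three_points q (q + h) (q + k) q1.
rewrite lerDl lerD2l => /(_ (ltW h0) hk).
have -> : q + k - q = k by ring.
have -> : q + k - (q + h) = k - h by ring.
have -> : q + h - q = h by ring.
lra.
Qed.

Lemma right_quotient_ge (x y h : R) : 1 <= y -> y < x -> 0 < h ->
  (f x - f y) / (x - y) <= right_quotient f x h.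
Proof.
move=> y1 yx h0.
rewrite /right_quotient ler_pdivlMl// mulrA ler_pdivrMr ?subr_gt0//.
have := @convex_three_points y x (x + h) y1 (ltW yx).
rewrite lerDl => /(_ (ltW h0)).
by rewrite (_ : x + h - x = h); [nra|ring].
Qed.

Hypothesis f_bounds : forall q, 1 <= q -> 1 - q <= f q <= 0.

(** The bounds force [f 1] to be 0, so every chord starting at 1 has slope at least -1, and
    convexity carries this over to all right quotients. At q = 1 the right quotient is itself such a
    slope. *)
Lemma right_quotient_geN1 (q h : R) : 1 <= q -> 0 < h ->
  - 1 <= right_quotient f q h.
Proof.
move=> q1 h0; have f1 : f 1 = 0.
  by apply/eqP; rewrite eq_le andbC -{1}(subrr 1) f_bounds.
have [q_gt1|] := ltP 1 q.
  apply: le_trans (right_quotient_ge (lexx 1) q_gt1 h0).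
  rewrite ler_pdivlMr ?subr_gt0// f1.
  by have /andP[+ _] := f_bounds q1; lra.
move=> q_le1; have -> : q = 1 by lra.
have /andP[+ _] : 1 - (1 + h) <= f (1 + h) <= 0.
  by apply: f_bounds; rewrite lerDl ltW.
by rewrite /right_quotient f1 ler_pdivlMl//; lra.
Qed.

(** Right quotients decrease with h and stay above -1, which gives the limit even at the endpoint
    1. *)
Lemma convex_right_derivable q : 1 <= q -> right_derivable f q.
Proof.
move=> q1; apply: nondecreasing_at_right_is_cvgr; near=> d.
- move=> h k; rewrite !in_itv/= => /andP[h0 _] _; exact: right_quotient_homo.
- exists (- 1) => _ [h /= + <-]; rewrite in_itv/= => /andP[h0 _].
  exact: right_quotient_geN1.
Unshelve. all: by end_near. Qed.

Lemma right_derive_geN1 q : 1 <= q -> - 1 <= right_derive f q.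
Proof.
move=> q1; apply: limr_ge; first exact: convex_right_derivable.
by near=> h; apply: right_quotient_geN1.
Unshelve. all: by end_near. Qed.

(** To the right of x, the chord slope dominates the right quotients with small h; to the left, it
    lies below all of them. Both comparisons survive the limit. *)
Lemma right_derive_support x y : 1 <= x -> 1 <= y ->
  f x + right_derive f x * (y - x) <= f y.
Proof.
move=> x1 y1; have [xy|yx|->] := ltgtP x y; last by rewrite subrr mulr0 addr0.
- rewrite addrC -lerBrDr -ler_pdivlMr ?subr_gt0//.
  apply: limr_le; first exact: convex_right_derivable.
  near=> h.
  have -> : (f y - f x) / (y - x) = right_quotient f x (y - x).
    by rewrite /right_quotient subrKC mulrC.
  apply: right_quotient_homo => //.
  by near: h; apply: nbhs_right_le; rewrite subr_gt0.
- suff : (f x - f y) / (x - y) <= right_derive f x.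
    by rewrite ler_pdivrMr ?subr_gt0//; lra.
  apply: limr_ge; first exact: convex_right_derivable.
  by near=> h; apply: right_quotient_ge.
Unshelve. all: by end_near. Qed.

End right_derivative_convex.

(** * Probability vectors realizing one line a - b q up to constants *)

Section plateau.
Context {R : realType} (n : nat) (a b : R).

Definition plateau_width : nat := Num.truncn (n%:R `^ a : R).

Definition plateau_rest : R := 1 - plateau_width%:R * n%:R `^ (- b).

(** The remaining mass is spread over all n points, because the complement of the plateau may be
    empty: for a = b = 1 the plateau is everything. *)
Definition plateau : 'rV[R]_n :=
  \row_i ((i < plateau_width)%:R * n%:R `^ (- b) + plateau_rest / n%:R).

Hypotheses (n2 : (2 <= n)%N) (a0 : 0 <= a) (ab : a <= b) (b1 : b <= 1).

Let n_ge1 : 1 <= n%:R :> R. Proof. by rewrite ler1n ltnW. Qed.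

Let n_gt0 : 0 < n%:R :> R. Proof. exact: lt_le_trans n_ge1. Qed.

Lemma plateau_width_le : plateau_width%:R <= n%:R `^ a :> R.
Proof. by rewrite truncn_le powR_ge0. Qed.

Lemma plateau_width_leq : (plateau_width <= n)%N.
Proof.
rewrite -(ler_nat R); apply: le_trans plateau_width_le _.
by rewrite ler1_powR// (le_trans ab).
Qed.

(** Rounding down a number that is at least 1 loses at most half of it. *)
Lemma plateau_width_ge : n%:R `^ a / 2 <= plateau_width%:R :> R.
Proof.
have na1 : 1 <= n%:R `^ a :> R by rewrite -[leLHS](powRr0 n%:R) ler_powR.
have w1 : 1 <= plateau_width%:R :> R by rewrite ler1n truncn_gt0.
have := truncnS_gt (n%:R `^ a : R); rewrite -/plateau_width -natr1.
lra.
Qed.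

Lemma plateau_rest_ge0 : 0 <= plateau_rest.
Proof.
rewrite subr_ge0 powRN ler_pdivrMr ?powR_gt0// mul1r.
by apply: le_trans plateau_width_le _; rewrite ler_powR.
Qed.

Lemma plateau_rest_le1 : plateau_rest <= 1.
Proof. by rewrite gerBl mulr_ge0 ?powR_ge0. Qed.

Lemma sum_plateau_width (c : R) :
  \sum_(i < n) (i < plateau_width)%:R * c = plateau_width%:R * c.
Proof.
rewrite -mulr_suml; congr (_ * _).
rewrite -[in RHS](card_ord plateau_width) -sum1_card natr_sum.
rewrite (big_ord_widen n (fun=> 1 : R)) ?plateau_width_leq// [RHS]big_mkcond.
by apply: eq_bigr => i _; case: ifP.
Qed.

Lemma plateau_prob : prob_vector plateau.
Proof.
split=> [i|].
  by rewrite mxE addr_ge0// ?mulr_ge0 ?powR_ge0 ?invr_ge0 ?plateau_rest_ge0.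
under eq_bigr do rewrite mxE.
rewrite big_split/= sum_plateau_width sumr_const card_ord.
by rewrite -[X in _ + X]mulr_natr divfK ?gt_eqF// subrKC.
Qed.

(** Only the plateau is kept, without its uniform part; the factor 1/2 comes from rounding its
    width. *)
Lemma plateau_power_sum_ge q : 1 <= q ->
  n%:R `^ (a - b * q) / 2 <= \sum_(i < n) plateau 0 i `^ q.
Proof.
move=> q1; have q0 : 0 < q by exact: lt_le_trans q1.
apply: (@le_trans _ _ (plateau_width%:R * n%:R `^ (- b * q))).
  rewrite -mulNr powRD ?lt0r_neq0 ?implybT// mulrAC.
  by apply: ler_wpM2r; [exact: powR_ge0|exact: plateau_width_ge].
rewrite powRrM -sum_plateau_width; apply: ler_sum => i _.
rewrite mxE -powR_bool_mul//.
have x0 : 0 <= (i < plateau_width)%:R * n%:R `^ (- b) :> R.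
  by rewrite mulr_ge0 ?powR_ge0.
have y0 : 0 <= plateau_rest / n%:R by rewrite divr_ge0 ?plateau_rest_ge0.
by rewrite ge0_ler_powR ?nnegrE ?addr_ge0 ?lerDl// ltW.
Qed.

(** The factor 2^q separates the plateau from the uniform part; the latter is at most 1/n per point,
    so its powers add up to at most n^(1 - q). *)
Lemma plateau_power_sum_le q : 1 <= q ->
  \sum_(i < n) plateau 0 i `^ q <=
  2 `^ q * (n%:R `^ (a - b * q) + n%:R `^ (1 - q)).
Proof.
move=> q1; have q0 : 0 < q by exact: lt_le_trans q1.
apply: (@le_trans _ _ (\sum_(i < n)
    2 `^ q * ((i < plateau_width)%:R * n%:R `^ (- b * q) + n%:R `^ (- q)))).
  apply: ler_sum => i _; rewrite mxE.
  have y0 : 0 <= plateau_rest / n%:R by rewrite divr_ge0 ?plateau_rest_ge0.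
  apply: le_trans (powRD_le _ y0 (ltW q0)) _.
    by rewrite mulr_ge0 ?powR_ge0.
  apply: ler_wpM2l; first exact: powR_ge0.
  rewrite powR_bool_mul// -powRrM lerD2l -[- q]mulN1r powRrM powR_inv1//.
  rewrite ge0_ler_powR ?nnegrE ?invr_ge0 ?(ltW q0)//.
  by rewrite ler_piMl ?invr_ge0 ?plateau_rest_le1.
rewrite -mulr_sumr big_split/= sum_plateau_width sumr_const card_ord.
apply: ler_wpM2l; first exact: powR_ge0.
rewrite -mulNr [n%:R `^ (a + _)]powRD ?lt0r_neq0 ?implybT//.
rewrite [n%:R `^ (1 + _)]powRD ?lt0r_neq0 ?implybT// powRr1//.
rewrite -[X in _ + X <= _]mulr_natl lerD2r ler_wpM2r ?powR_ge0//.
exact: plateau_width_le.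
Qed.

End plateau.

(** * A sequence returning infinitely often to every right neighbourhood *)

Lemma unpickle_pair_frequent (T : countType) (x : T) (N : nat) :
  exists2 n, (N <= n)%N &
    exists m, @unpickle (nat * T)%type n = Some (m, x).
Proof.
pose g (m : nat) := pickle (m, x).
have [m Nm] : exists m, (N <= g m)%N.
  (* Pigeonhole: if all codes of pairs (m, x) were below N, then N + 1 of them would inject into N
     values. *)
  apply: contrapT => /forallNP gN.
  have g_lt m : (g m < N)%N by rewrite ltnNge; apply/negP/gN.
  pose h (i : 'I_N.+1) : 'I_N := Ordinal (g_lt i).
  have : injective h.
    by move=> i j /(congr1 val)/= /(pcan_inj pickleK)[] /val_inj.
  by move=> /leq_card; rewrite !card_ord ltnn.
by exists (g m) => //; exists m; rewrite pickleK.
Qed.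

(** Pairing a rational with an arbitrary natural number repeats it infinitely often. The maximum
    with 1 keeps all values in the domain and does not alter rationals above x. *)
Lemma frequently_dense_sequence (R : realType) : exists r : nat -> R,
  (forall n, 1 <= r n) /\
  (forall x e N, 1 <= x -> 0 < e -> exists2 n, (N <= n)%N & x < r n < x + e).
Proof.
exists (fun n => if @unpickle (nat * rat)%type n is Some (_, s)
                 then Num.max 1 (ratr s) else 1); split=> [n|x e N x1 e0].
  by case: unpickle => [[_ s]|]//; rewrite le_max lexx.
have /rat_in_itvoo[s] : x < x + e by rewrite ltrDl.
rewrite in_itv/= => /andP[xs se].
have [n Nn [m nE]] := unpickle_pair_frequent s N.
exists n => //; rewrite nE max_r ?xs//.
exact: le_trans x1 (ltW xs).
Qed.

(** Constant factors of power sums thereby become invisible after division by log n. *)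
Lemma near_div_ln_le (R : realType) (c e : R) : 0 < e ->
  \forall n \near \oo, c / ln n%:R <= e.
Proof.
move=> e0; near=> n.
have n2 : (2 <= n)%N by near: n; exact: nbhs_infty_ge.
have ln0 : 0 < ln n%:R :> R by rewrite ln_gt0// ltr1n.
rewrite ler_pdivrMr// -ler_pdivrMl// -ler_expR lnK ?posrE ?ltr0n 1?ltnW//.
by near: n; exact: nbhs_infty_ger.
Unshelve. all: by end_near. Qed.

(** * Necessity of the three properties *)

Section mass_exponent_properties.
Context {R : realType} (mu : forall n, 'rV[R]_n) (tau : R -> R).
Hypothesis mu_tau : is_mass_exponent mu tau.

Let u q n : R := ln (\sum_(i < n) mu n 0 i `^ q) / ln n%:R.

Let u_tau q : 1 <= q -> limn_esup (fun n => (u q n)%:E) = (tau q)%:E.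
Proof. by move=> q1; case: mu_tau => _ /(_ _ q1). Qed.

Let mu_prob n : (2 <= n)%N -> prob_vector (mu n).
Proof. by case: mu_tau => + _; exact. Qed.

Let ln_nat_gt0 n : (2 <= n)%N -> 0 < ln n%:R :> R.
Proof. by move=> n2; rewrite ln_gt0// ltr1n. Qed.

Lemma mass_exponent_bounds q : 1 <= q -> 1 - q <= tau q <= 0.
Proof.
move=> q1; apply/andP; split.
(* Comparing just two sequences takes the coefficients 1 and 0, with a repeated sequence as a
   placeholder. *)
- have := @limn_esup_affine_le R _ _ _ _ _ _ 1 0 ler01 (lexx 0)
    (limn_esup_cst (1 - q)) (u_tau q1) (u_tau q1).
  rewrite mul1r mul0r addr0; apply; near=> n.
  have n2 : (2 <= n)%N by near: n; exact: nbhs_infty_ge.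
  rewrite mul1r mul0r addr0 ler_pdivlMr ?ln_nat_gt0// -ln_powR ler_ln ?posrE.
  + exact: power_sum_ge (mu_prob n2) _ q1.
  + by rewrite powR_gt0// ltr0n ltnW.
  + exact: power_sum_gt0 (mu_prob n2) q.
- have := @limn_esup_affine_le R _ _ _ _ _ _ 0 0 (lexx 0) (lexx 0)
    (u_tau q1) (u_tau q1) (u_tau q1).
  rewrite mul0r addr0; apply; near=> n.
  have n2 : (2 <= n)%N by near: n; exact: nbhs_infty_ge.
  rewrite !mul0r addr0 ler_pdivrMr ?ln_nat_gt0// mul0r ln_le0//.
  exact: power_sum_le1 (mu_prob n2) _ q1.
Unshelve. all: by end_near. Qed.

Lemma mass_exponent_convex : convex_function [set q : R^o | 1 <= q] tau.
Proof.
move=> t q r; rewrite !inE/= => q1 r1; rewrite !convRE/=.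
have t01 : 0 <= t%:num <= 1 by rewrite ge0 le1.
have /andP[t0 t1] := t01.
have m1 : 1 <= t%:num * q + (1 - t%:num) * r by nra.
have t1' : 0 <= 1 - t%:num by rewrite subr_ge0.
apply: (limn_esup_affine_le t0 t1' (u_tau m1) (u_tau q1) (u_tau r1)).
near=> n; have n2 : (2 <= n)%N by near: n; exact: nbhs_infty_ge.
rewrite /u !mulrA -mulrDl ler_pM2r ?invr_gt0 ?ln_nat_gt0//.
exact: ln_power_sum_convex (mu_prob n2) _ _ _ t01 q1 r1.
Unshelve. all: by end_near. Qed.

Lemma mass_exponent_homo q r : 1 <= q -> q <= r -> tau r <= r / q * tau q.
Proof.
move=> q1 qr; have r1 := le_trans q1 qr.
have rq0 : 0 <= r / q by rewrite divr_ge0// (le_trans ler01).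
have := limn_esup_affine_le rq0 (lexx 0) (u_tau r1) (u_tau q1) (u_tau q1).
rewrite mul0r addr0; apply; near=> n.
have n2 : (2 <= n)%N by near: n; exact: nbhs_infty_ge.
rewrite mul0r addr0 /u mulrA ler_pM2r ?invr_gt0 ?ln_nat_gt0//.
exact: ln_power_sum_homo (mu_prob n2) _ _ q1 qr.
Unshelve. all: by end_near. Qed.

(** By [mass_exponent_homo] at q + h, every right quotient is at most tau(q)/q; convexity and the
    bounds provide the limit. *)
Lemma mass_exponent_right_derive q : 1 <= q ->
  right_derivable tau q /\ right_derive tau q <= tau q / q.
Proof.
move=> q1; have q0 : 0 < q by exact: lt_le_trans q1.
have tau_q : right_derivable tau q.
  exact: (convex_right_derivable mass_exponent_convex mass_exponent_bounds).
split=> //; apply: limr_le => //; near=> h.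
rewrite /right_quotient ler_pdivrMl//.
have : tau (q + h) <= (q + h) / q * tau q.
  by apply: mass_exponent_homo => //; rewrite lerDl.
rewrite (_ : (q + h) / q * tau q = tau q + h * (tau q / q)); first by lra.
by field; rewrite gt_eqF.
Unshelve. all: by end_near. Qed.

End mass_exponent_properties.

(** * Sufficiency: realizing a given function *)

Section realization.
Context {R : realType} (tau : R -> R).
Hypothesis tau_bounds : forall q, 1 <= q -> 1 - q <= tau q <= 0.
Hypothesis tau_convex : convex_function [set q : R^o | 1 <= q] tau.
Hypothesis tau_derive : forall q, 1 <= q -> right_derive tau q <= tau q / q.

(* The support line of [tau] at [x] is [q |-> icpt x - slope x * q]. *)
Let slope x := - right_derive tau x.
Let icpt x := tau x - right_derive tau x * x.

Let slope_icpt x : 1 <= x -> [/\ 0 <= icpt x, icpt x <= slope x & slope x <= 1].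
Proof.
move=> x1; have x0 : 0 < x by exact: lt_le_trans x1.
split; rewrite /icpt /slope.
- by rewrite subr_ge0 -ler_pdivlMr// tau_derive.
- have := right_derive_support tau_convex tau_bounds x1 (lexx 1).
  have /andP[_] := tau_bounds (lexx 1); lra.
- by rewrite lerNl right_derive_geN1.
Qed.

Let icpt_support x q : 1 <= x -> 1 <= q -> icpt x - slope x * q <= tau q.
Proof.
move=> x1 q1; have := right_derive_support tau_convex tau_bounds x1 q1.
by rewrite /icpt /slope; lra.
Qed.

(** The support line at x has slope at most tau(x)/x <= 0, so at q < x its value is at least tau(x).
    By the support line at q, whose slope is at least -1, tau(x) >= tau(q) - (x - q). *)
Let icpt_approx x q : 1 <= q -> q < x ->
  tau q - (x - q) <= icpt x - slope x * q.
Proof.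
move=> q1 qx; have x1 : 1 <= x by lra.
have := right_derive_support tau_convex tau_bounds q1 x1.
have := right_derive_geN1 tau_convex tau_bounds q1.
have := tau_derive x1; have /andP[_ tau_x] := tau_bounds x1.
have : tau x / x <= 0 by rewrite ler_pdivrMr ?mul0r// (lt_le_trans ltr01).
by rewrite /icpt /slope; nra.
Qed.

Lemma mass_exponent_exists : exists mu, is_mass_exponent mu tau.
Proof.
have [r [r1 r_dense]] := frequently_dense_sequence R.
exists (fun n => plateau n (icpt (r n)) (slope (r n))); split=> [n n2|q q1].
  by have [? ? ?] := slope_icpt (r1 n); exact: plateau_prob.
(* The upper bound must hold for all large n, the lower bound only for infinitely many n, which may
   depend on q. *)
apply/limn_esup_EFinP; split=> e e0.
- near=> n.
  have n2 : (2 <= n)%N by near: n; exact: nbhs_infty_ge.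
  have n0 : 0 < n%:R :> R by rewrite ltr0n ltnW.
  have n1 : 1 <= n%:R :> R by rewrite ler1n ltnW.
  have ln0 : 0 < ln n%:R :> R by rewrite ln_gt0// ltr1n.
  have [a0 ab b1] := slope_icpt (r1 n).
  rewrite ler_pdivrMr//.
  (* The factor 2^q comes from [plateau_power_sum_le]; one more 2 arises because both powers of n
     there are at most n^tau(q), one by the support line and the other by tau(q) >= 1 - q. *)
  apply: (@le_trans _ _ (ln (2 `^ (q + 1) * n%:R `^ tau q))).
    rewrite ler_ln ?posrE ?mulr_gt0 ?powR_gt0//; last first.
      exact: power_sum_gt0 (plateau_prob n2 ab b1) q.
    apply: le_trans (plateau_power_sum_le n2 ab b1 q1) _.
    rewrite [2 `^ (q + 1)]powRD ?pnatr_eq0 ?implybT// powRr1// -mulrA.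
    apply: ler_wpM2l; first exact: powR_ge0.
    rewrite mulr_natl mulr2n lerD// ler_powR// ?icpt_support//.
    by case/andP: (tau_bounds q1).
  rewrite lnM ?posrE ?powR_gt0// !ln_powR [leLHS]addrC [leRHS]mulrDl.
  rewrite lerD2l -ler_pdivrMr//.
  by near: n; exact: near_div_ln_le.
(* One half of e pays for the distance from q to the visited point, the other for the factor 1/2 in
   [plateau_power_sum_ge]. *)
- move=> N; have e20 : 0 < e / 2 by rewrite divr_gt0.
  have [M _ HM] : \forall n \near \oo, (2 <= n)%N /\ ln 2 / ln n%:R <= e / 2.
    by near=> n; split; near: n; [exact: nbhs_infty_ge|exact: near_div_ln_le].
  have [n] := r_dense q (e / 2) (maxn N M) q1 e20.
  rewrite geq_max => /andP[Nn /HM[n2 ln2e]] /andP[qr re].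
  exists n => //.
  have n0 : 0 < n%:R :> R by rewrite ltr0n ltnW.
  have ln0 : 0 < ln n%:R :> R by rewrite ln_gt0// ltr1n.
  have [a0 ab b1] := slope_icpt (r1 n).
  rewrite ler_pdivlMr//.
  apply: (@le_trans _ _
      (ln (n%:R `^ (icpt (r n) - slope (r n) * q) / 2))); last first.
    rewrite ler_ln ?posrE ?divr_gt0 ?powR_gt0//.
      exact: plateau_power_sum_ge.
    exact: power_sum_gt0 (plateau_prob n2 ab b1) q.
  rewrite ln_div ?posrE ?powR_gt0// ln_powR.
  move: ln2e; rewrite ler_pdivrMr// => ln2e.
  have : (tau q - e / 2) * ln n%:R <=
      (icpt (r n) - slope (r n) * q) * ln n%:R.
    rewrite ler_pM2r//; apply: le_trans (icpt_approx q1 qr); lra.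
  by lra.
Unshelve. all: by end_near. Qed.

End realization.

Theorem theorem1p3 (R : realType) (tau : R -> R) :
  (exists mu : forall n : nat, 'rV[R]_n, is_mass_exponent mu tau) <->
  [/\ forall q : R, 1 <= q -> 1 - q <= tau q <= 0,
      convex_function [set q : R^o | 1 <= q] tau
    & forall q : R, 1 <= q ->
        right_derivable tau q /\ right_derive tau q <= tau q / q].
Proof.
split=> [[mu mu_tau]|[tau_bounds tau_convex tau_derive]].
  split; first exact: mass_exponent_bounds mu_tau.
    exact: mass_exponent_convex mu_tau.
  exact: mass_exponent_right_derive mu_tau.
by apply: mass_exponent_exists => // q /tau_derive[].
Qed.
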